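(* Let $n\in\{3,4\}$ and let $C\subseteq T^{n-1}_{n,n}$ be a maximal cone. Then $C$ is positive if and only if its cartoon does not contain a marked triangle.
   Context: $\mathcal C=\bigcup_{m\ge1}\mathbb C((t^{1/m}))$ is the field of Puiseux series with valuation $\operatorname{val}$ (lowest exponent) and leading coefficient $\operatorname{lc}$; $\mathcal C_+=\{x\in\mathcal C\mid\operatorname{lc}(x)\in\mathbb R_{>0}\}$. For $S\subseteq\mathcal C^{N}$, $\operatorname{trop}(S)$ is the closure of $\{\operatorname{val}(z)\mid z\in S\cap(\mathcal C^* )^{N}\}$. $T^{n-1}_{n,n}=\operatorname{trop}(V(\det))$ where $\det=\sum_{\sigma\in S_n}\operatorname{sgn}(\sigma)\prod_ix_{i\sigma(i)}$. It is the codimension-$1$ skeleton of the normal fan of the Birkhoff polytope $B_n$ (convex hull of permutation matrices); its maximal cones are dual to the edges $\operatorname{conv}(\sigma,\pi)$ of $B_n$ ($\sigma,\pi\in S_n$ form an edge iff $\sigma\pi^{-1}$ is a nontrivial cycle), the dual cone being the set of $w$ such that $\min_{\tau}\sum_iw_{i\tau(i)}$ is attained at $\sigma$ and $\pi$. A cone is positive if it is contained in $\operatorname{trop}(V(\det)\cap\mathcal C_+^{n\times n})$. Cartoon of $C$: if $C$ is dual to $\operatorname{conv}(\sigma,\pi)$, decorate the complete graph $K_n$ on nodes $v_1,\dots,v_n$ with $n$ markings, one for each $j\in[n]$: if $\sigma^{-1}(j)\ne\pi^{-1}(j)$, the $j$-th marking is put on (the interior of) the edge $v_{\sigma^{-1}(j)}v_{\pi^{-1}(j)}$;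 if $\sigma^{-1}(j)=\pi^{-1}(j)$, it is put on the node $v_{\sigma^{-1}(j)}$. A marked triangle is a triangle of $K_n$ together with three distinct markings, one for each edge of the triangle, such that the marking chosen for an edge lies in the interior of that edge or on a vertex incident to that edge. *)

(* Defs.v *)
From HB Require Import structures.
From mathcomp Require Import all_boot all_order all_fingroup all_algebra.
From mathcomp Require Import all_classical all_reals all_analysis.
From mathcomp Require Import complex.

Set Implicit Arguments.
Unset Strict Implicit.
Unset Printing Implicit Defensive.

Import Order.TTheory GRing.Theory Num.Theory.
Import numFieldNormedType.Exports.

Local Open Scope classical_set_scope.
Local Open Scope ring_scope.

(* A Puiseux series [\sum_(k >= N) c_k t^(k/m)] is encoded by its coefficient
   function [rat -> F], sending an exponent q to the coefficient of t^q; the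
   set of exponents must lie in [1/m Z] for some m >= 1 and be bounded below. *)
Definition puiseux_support (A : set rat) : Prop :=
  exists (m : nat) (N : int), (0 < m)%N /\
    forall q, A q -> exists2 k : int, (N <= k)%R & q = k%:~R / m%:R.

Record puiseux (F : comNzRingType) := Puiseux {
  pcoef :> rat -> F;
  pcoefP : puiseux_support [set q | pcoef q != 0] }.

Lemma puiseuxP (F : comNzRingType) (f g : puiseux F) :
  (forall q, f q = g q) -> f = g.
Proof.
case: f g => f fP [g gP] /= fg; have e : f = g by apply/funext.
by case: _ / e gP => gP; congr Puiseux; exact: Prop_irrelevance.
Qed.

Lemma puiseux_support_sub (A B : set rat) :
  A `<=` B -> puiseux_support B -> puiseux_support A.
Proof. by move=> AB [m [N [m0 BP]]]; exists m, N; split=> // q /AB /BP. Qed.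

Lemma puiseux_support_widen (A : set rat) (m : nat) (N : int) (p : nat) :
  (0 < m)%N -> (0 < p)%N ->
  (forall q, A q -> exists2 k : int, (N <= k)%R & q = k%:~R / m%:R) ->
  forall q, A q -> exists2 k : int, (N * p%:Z <= k)%R
                                  & q = k%:~R / (m * p)%:R.
Proof.
move=> m0 p0 AP q /AP [k Nk ->]; exists (k * p%:Z); first by rewrite ler_wpM2r.
rewrite intrM natrM -pmulrn -mulf_div divff ?mulr1//.
by rewrite pnatr_eq0 -lt0n.
Qed.

Lemma puiseux_supportU (A B : set rat) :
  puiseux_support A -> puiseux_support B -> puiseux_support (A `|` B).
Proof.
move=> [m [M [m0 AP]]] [n [N [n0 BP]]].
exists (m * n)%N, (Order.min (M * n%:Z) (N * m%:Z)).
split=> [|q [|]]; first by rewrite muln_gt0 m0.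
- by move=> /(puiseux_support_widen m0 n0 AP)[k Mk ->]; exists k;
    rewrite ?ge_min ?Mk.
- by move=> /(puiseux_support_widen n0 m0 BP)[k Nk ->]; exists k;
    rewrite ?ge_min ?Nk ?orbT// mulnC.
Qed.

Definition sumset (A B : set rat) : set rat :=
  [set q | exists2 a, A a & B (q - a)].

Lemma puiseux_support_sumset (A B : set rat) :
  puiseux_support A -> puiseux_support B -> puiseux_support (sumset A B).
Proof.
move=> [m [M [m0 AP]]] [n [N [n0 BP]]].
exists (m * n)%N, (M * n%:Z + N * m%:Z).
split=> [|q [a Aa Bqa]]; first by rewrite muln_gt0 m0.
have [k Mk aE] := puiseux_support_widen m0 n0 AP Aa.
have [l Nl bE] := puiseux_support_widen n0 m0 BP Bqa.
exists (k + l); first exact: lerD.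
by rewrite intrD mulrDl -aE mulnC -bE addrC subrK.
Qed.

Lemma puiseux_support_lb (A : set rat) :
  puiseux_support A -> exists L, forall q, A q -> L <= q.
Proof.
move=> [m [N [m0 AP]]]; exists (N%:~R / m%:R) => q /AP[k Nk ->].
by rewrite ler_pM2r ?ler_int// invr_gt0 ltr0n.
Qed.

Lemma puiseux_support_cover (A : set rat) (u : rat) : puiseux_support A ->
  exists2 s : seq rat, uniq s & forall q, A q -> q <= u -> q \in s.
Proof.
move=> [m [N [m0 AP]]].
pose K := `|Num.floor (u * m%:R) - N|%N.
exists (undup [seq (N + i%:Z)%:~R / m%:R | i <- iota 0 K.+1]).
  exact: undup_uniq.
move=> q /AP[k Nk ->] ku; rewrite mem_undup.
have {}ku : k <= Num.floor (u * m%:R).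
  by rewrite floor_ge_int_tmp -ler_pdivrMr ?ltr0n.
apply/mapP; exists (`|k - N|%N).
  rewrite mem_iota add0n ltnS /K /= -lez_nat.
  by rewrite !gez0_abs ?subr_ge0 ?(le_trans Nk)// lerD2r.
by rewrite gez0_abs ?subr_ge0// [N + _]addrC subrK.
Qed.

Lemma puiseux_support0 (F : comNzRingType) :
  puiseux_support [set q : rat | (0 : F) != 0].
Proof. by exists 1%N, 0; split=> // q /=; rewrite eqxx. Qed.
Definition puiseux0 (F : comNzRingType) : puiseux F :=
  Puiseux (puiseux_support0 F).

Lemma puiseux_supportN (F : comNzRingType) (f : puiseux F) :
  puiseux_support [set q | - f q != 0].
Proof.
by apply: (puiseux_support_sub _ (pcoefP f)) => q /=; rewrite oppr_eq0.
Qed.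
Definition puiseux_opp (F : comNzRingType) (f : puiseux F) : puiseux F :=
  Puiseux (puiseux_supportN f).

Lemma puiseux_supportD (F : comNzRingType) (f g : puiseux F) :
  puiseux_support [set q | f q + g q != 0].
Proof.
apply: (puiseux_support_sub _ (puiseux_supportU (pcoefP f) (pcoefP g))) => q /=.
by have [->|fq _] := eqVneq (f q) 0; [rewrite add0r; right | left].
Qed.
Definition puiseux_add (F : comNzRingType) (f g : puiseux F) : puiseux F :=
  Puiseux (puiseux_supportD f g).

(* The Cauchy product: only finitely many terms of the sum are nonzero. *)
Definition cauchy_coef (F : comNzRingType) (f g : puiseux F) (q : rat) : F :=
  \sum_(a \in [set: rat]) f a * g (q - a).

Lemma cauchy_coefE (F : comNzRingType) (f g : puiseux F) (q : rat)
    (s : seq rat) : uniq s ->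
  (forall a, f a != 0 -> g (q - a) != 0 -> a \in s) ->
  cauchy_coef f g q = \sum_(a <- s) f a * g (q - a).
Proof.
move=> us sP; rewrite /cauchy_coef (fsbigE s)//.
  by apply: eq_bigl => a; rewrite in_setT.
move=> a _; apply: contraNeq => fg; apply: sP; apply: contra_neq fg => ->.
  by rewrite mul0r.
by rewrite mulr0.
Qed.

Lemma cauchy_cover (F : comNzRingType) (f g : puiseux F) (q : rat) :
  exists2 s : seq rat, uniq s &
    forall a r, f a != 0 -> g (r - a) != 0 -> r <= q -> a \in s.
Proof.
have [L gL] := puiseux_support_lb (pcoefP g).
have [s us sP] := puiseux_support_cover (q - L) (pcoefP f).
exists s => // a r fa ga rq; apply: sP => //.
by rewrite lerBrDr (le_trans _ rq)// -lerBrDl; exact: gL.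
Qed.

Lemma cauchy_coef_neq0 (F : comNzRingType) (f g : puiseux F) (q : rat) :
  cauchy_coef f g q != 0 -> exists2 a, f a != 0 & g (q - a) != 0.
Proof.
move=> fg0; apply: contrapT => no; move: fg0.
rewrite /cauchy_coef fsbig1 ?eqxx// => a _; apply: contrapT => /eqP fg.
by apply: no; exists a; apply: contra_neq fg => ->; rewrite ?mul0r ?mulr0.
Qed.

Lemma puiseux_support_cauchy (F : comNzRingType) (f g : puiseux F) :
  puiseux_support [set q | cauchy_coef f g q != 0].
Proof.
apply: (puiseux_support_sub _ (puiseux_support_sumset (pcoefP f) (pcoefP g))).
by move=> q /= /cauchy_coef_neq0[a fa ga]; exists a.
Qed.
Definition puiseux_mul (F : comNzRingType) (f g : puiseux F) : puiseux F :=
  Puiseux (puiseux_support_cauchy f g).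

Lemma puiseux_support1 (F : comNzRingType) :
  puiseux_support [set q : rat | (q == 0)%:R != 0 :> F].
Proof.
exists 1%N, 0; split=> // q /=; have [->|] := eqVneq q 0; last by rewrite eqxx.
by exists 0; rewrite ?mul0r.
Qed.
Definition puiseux1 (F : comNzRingType) : puiseux F :=
  Puiseux (puiseux_support1 F).

Lemma puiseux_addA (F : comNzRingType) : associative (@puiseux_add F).
Proof. by move=> f g h; apply/puiseuxP => q /=; rewrite addrA. Qed.
Lemma puiseux_addC (F : comNzRingType) : commutative (@puiseux_add F).
Proof. by move=> f g; apply/puiseuxP => q /=; rewrite addrC. Qed.
Lemma puiseux_add0 (F : comNzRingType) :
  left_id (puiseux0 F) (@puiseux_add F).
Proof. by move=> f; apply/puiseuxP => q /=; rewrite add0r. Qed.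
Lemma puiseux_addN (F : comNzRingType) :
  left_inverse (puiseux0 F) (@puiseux_opp F) (@puiseux_add F).
Proof. by move=> f; apply/puiseuxP => q /=; rewrite addNr. Qed.

HB.instance Definition _ (F : comNzRingType) := gen_eqMixin (puiseux F).
HB.instance Definition _ (F : comNzRingType) := gen_choiceMixin (puiseux F).
HB.instance Definition _ (F : comNzRingType) :=
  GRing.isZmodule.Build (puiseux F) (@puiseux_addA F) (@puiseux_addC F)
    (@puiseux_add0 F) (@puiseux_addN F).

Lemma puiseux_mulC (F : comNzRingType) : commutative (@puiseux_mul F).
Proof.
move=> f g; apply/puiseuxP => q /=; rewrite /cauchy_coef.
rewrite (reindex_fsbigT (fun a : rat => q - a)).
  by apply: eq_fsbigr => a _; rewrite subKr mulrC.
by exists (fun a => q - a) => a; rewrite subKr.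
Qed.

Lemma puiseux_mul1 (F : comNzRingType) :
  left_id (puiseux1 F) (@puiseux_mul F).
Proof.
move=> f; apply/puiseuxP => q /=; rewrite (@cauchy_coefE _ _ _ _ [:: 0])//=.
  by rewrite big_seq1 eqxx mul1r subr0.
by move=> a; have [->|] := eqVneq a 0; rewrite ?inE ?eqxx.
Qed.

Lemma puiseux_mulDl (F : comNzRingType) :
  left_distributive (@puiseux_mul F) (@puiseux_add F).
Proof.
move=> f g h; apply/puiseuxP => q /=.
have [s us sP] := cauchy_cover f h q.
have [s' us' sP'] := cauchy_cover g h q.
have sub a : f a != 0 \/ g a != 0 -> h (q - a) != 0 -> a \in undup (s ++ s').
  rewrite mem_undup mem_cat => -[fa|ga] ha; first by rewrite (sP a q).
  by rewrite (sP' a q) ?orbT.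
rewrite !(@cauchy_coefE _ _ _ _ (undup (s ++ s'))) ?undup_uniq//=.
- by rewrite -big_split; apply: eq_bigr => a _; rewrite mulrDl.
- by move=> a ga; apply: sub; right.
- by move=> a fa; apply: sub; left.
- move=> a fga; apply: sub.
  by have [fa|] := eqVneq (f a) 0; [right; rewrite fa add0r in fga | left].
Qed.

Lemma puiseux_mulA (F : comNzRingType) : associative (@puiseux_mul F).
Proof.
move=> f g h; apply/puiseuxP => q /=; apply/esym.
have [L hL] := puiseux_support_lb (pcoefP h).
have hq c : h (q - c) != 0 -> c <= q - L.
  by move=> hc; rewrite lerBrDr addrC -lerBrDr; exact: hL.
have [s us sP] := cauchy_cover f g (q - L).
have [s' us' sP'] := puiseux_support_cover (q - L)
  (puiseux_support_sumset (pcoefP f) (pcoefP g)).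
have fgE c : h (q - c) != 0 ->
    cauchy_coef f g c = \sum_(a <- s) f a * g (c - a).
  move=> hc; apply: cauchy_coefE => // a fa ga.
  by apply: (sP a c) => //; exact: hq.
rewrite (@cauchy_coefE _ _ _ _ s')//=; last first.
  by move=> c /cauchy_coef_neq0[a fa ga] hc; apply: sP' (hq _ hc); exists a.
have -> : \sum_(c <- s') cauchy_coef f g c * h (q - c) =
    \sum_(c <- s') \sum_(a <- s) f a * (g (c - a) * h (q - c)).
  apply: eq_bigr => c _; have [->|hc] := eqVneq (h (q - c)) 0.
    by rewrite mulr0 big1// => a _; rewrite !mulr0.
  by rewrite fgE// mulr_suml; apply: eq_bigr => a _; rewrite mulrA.
rewrite exchange_big /= (@cauchy_coefE _ _ _ _ s)//=; last first.
  move=> a fa /cauchy_coef_neq0[b gb hb].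
  apply: (sP a (a + b)) => //; first by rewrite addrC addKr.
  by apply: hq; rewrite opprD addrA.
apply: eq_bigr => a _; rewrite -mulr_sumr.
have [->|fa] := eqVneq (f a) 0; first by rewrite !mul0r.
congr (_ * _); rewrite /cauchy_coef (reindex_fsbigT (fun c : rat => c - a)).
  rewrite [RHS](fsbigE s')//.
    apply: eq_big => [c|c _]; first by rewrite in_setT.
    by rewrite opprB addrA subrK.
  move=> c _; apply: contraNeq => gh; apply: sP'.
    exists a => //=; apply: contra_neq gh => ->; by rewrite mul0r.
  apply: hq; apply: contra_neq gh; rewrite opprB addrA subrK => ->.
  by rewrite mulr0.
by exists (fun c => c + a) => c; rewrite ?subrK ?addrK.
Qed.

Lemma puiseux1_neq0 (F : comNzRingType) : puiseux1 F != 0.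
Proof.
apply/eqP => /(congr1 (fun f : puiseux F => f 0)) /= /eqP.
by rewrite oner_eq0.
Qed.

HB.instance Definition _ (F : comNzRingType) :=
  GRing.Zmodule_isComNzRing.Build (puiseux F) (@puiseux_mulA F)
    (@puiseux_mulC F) (@puiseux_mul1 F) (@puiseux_mulDl F) (@puiseux1_neq0 F).

(* Lowest exponent; the value at 0, where the valuation is infinite, is a
   dummy. *)
Definition pval (F : comNzRingType) (f : puiseux F) : rat :=
  xget 0 [set q | f q != 0 /\ forall r, r < q -> f r = 0].

Definition plc (F : comNzRingType) (f : puiseux F) : F := f (pval f).

Lemma pvalP (F : comNzRingType) (f : puiseux F) : f != 0 ->
  plc f != 0 /\ forall r, r < pval f -> f r = 0.
Proof.
move=> f0; have [q fq] : exists q, f q != 0.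
  apply: contrapT => /forallNP ff; move/eqP: f0; apply; apply/puiseuxP => q.
  by have /negP := ff q; rewrite negbK => /eqP.
suff : exists r, f r != 0 /\ forall r', r' < r -> f r' = 0.
  move=> [r rP]; rewrite /plc /pval; case: xgetP => [x _ //|] no.
  by case: (no r).
have [s _ sP] := puiseux_support_cover q (pcoefP f).
case: (@arg_minP _ _ (seq_sub s) (SeqSub (sP q fq (lexx q)))
  (fun x => f (ssval x) != 0) (@ssval _ s)) => //= x fx xmin.
exists (ssval x); split=> // r rx; apply: contraTeq rx => fr; rewrite -leNgt.
have [rq|/ltW qr] := leP r q; first exact: (xmin (SeqSub (sP r fr rq))).
by apply: le_trans qr; exact: (xmin (SeqSub (sP q fq (lexx q)))).
Qed.

(* [0 < z] in R[i] means that z is real and positive. *)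
Definition ppos (R : realType) (f : puiseux R[i]) : Prop := 0 < plc f.

Definition trop (R : realType) (m n : nat) (S : set 'M[puiseux R[i]]_(m, n)) :
    set 'M[R]_(m, n) :=
  closure [set w : 'M[R]_(m, n) | exists z,
    [/\ S z, forall i j, z i j != 0
       & w = \matrix_(i, j) ratr (pval (z i j))]].

Definition det_variety (R : realType) (n : nat) : set 'M[puiseux R[i]]_n :=
  [set z | \det z = 0].

Definition positive_matrices (R : realType) (n : nat) :
    set 'M[puiseux R[i]]_n :=
  [set z | forall i j, ppos (z i j)].

Definition tropical_det (R : realType) (n : nat) : set 'M[R]_n :=
  trop (@det_variety R n).

Definition convex_hull (R : realType) (V : lmodType R) (A : set V) : set V :=
  [set x | exists (k : nat) (l : 'I_k -> R) (p : 'I_k -> V),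
    [/\ forall i, A (p i), forall i, 0 <= l i, \sum_i l i = 1
      & x = \sum_i l i *: p i]].

Definition mxdot (R : realType) (m n : nat) (w x : 'M[R]_(m, n)) : R :=
  \sum_i \sum_j w i j * x i j.

Definition face_of (R : realType) (m n : nat) (P F : set 'M[R]_(m, n)) : Prop :=
  exists w, F = [set x | P x /\ forall y, P y -> mxdot w x <= mxdot w y].

Definition normal_cone (R : realType) (m n : nat) (P F : set 'M[R]_(m, n)) :
    set 'M[R]_(m, n) :=
  [set w | forall x y, F x -> P y -> mxdot w x <= mxdot w y].

Definition normal_fan (R : realType) (m n : nat) (P : set 'M[R]_(m, n)) :
    set (set 'M[R]_(m, n)) :=
  [set C | exists F, [/\ face_of P F, F !=set0 & C = normal_cone P F]].

Definition birkhoff (R : realType) (n : nat) : set 'M[R]_n :=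
  convex_hull (range (fun s : 'S_n => perm_mx s)).

(* The fan structure on [tropical_det R n] is the subfan of the normal fan of
   the Birkhoff polytope formed by the cones contained in it. *)
Definition maximal_cone (R : realType) (n : nat) (C : set 'M[R]_n) : Prop :=
  [/\ normal_fan (@birkhoff R n) C, C `<=` @tropical_det R n &
      forall D, normal_fan (@birkhoff R n) D -> D `<=` @tropical_det R n ->
        C `<=` D -> D = C].

Definition positive_cone (R : realType) (n : nat) (C : set 'M[R]_n) : Prop :=
  C `<=` trop (@det_variety R n `&` @positive_matrices R n).

Definition perm_segment (R : realType) (n : nat) (s p : 'S_n) : set 'M[R]_n :=
  convex_hull [set perm_mx s; perm_mx p].

Definition birkhoff_edge (R : realType) (n : nat) (s p : 'S_n) : Prop :=
  s <> p /\ face_of (@birkhoff R n) (@perm_segment R n s p).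

(* As [mxdot w (perm_mx t) = \sum_i w i (t i)], the normal cone below is the
   set of w for which the minimum over t of these sums is attained at both s
   and p. *)
Definition dual_to (R : realType) (n : nat) (C : set 'M[R]_n) (s p : 'S_n) :
    Prop :=
  birkhoff_edge R s p /\
  C = normal_cone (@birkhoff R n) (@perm_segment R n s p).

(* A cartoon sends each marking j to its position on K_n, encoded as a set of
   nodes: [set u] is the node u, and [set u; v] with u <> v is the interior of
   the edge uv. *)
Definition cartoon (n : nat) (s p : 'S_n) : {ffun 'I_n -> {set 'I_n}} :=
  [ffun j => if (s^-1)%g j != (p^-1)%g j then [set (s^-1)%g j; (p^-1)%g j]%SET
             else [set (s^-1)%g j]%SET].

Definition cartoon_of (R : realType) (n : nat) (C : set 'M[R]_n)
    (K : {ffun 'I_n -> {set 'I_n}}) : Prop :=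
  exists s p : 'S_n, dual_to C s p /\ K = cartoon s p.

Definition marks_edge (n : nat) (K : {ffun 'I_n -> {set 'I_n}})
    (j u v : 'I_n) : bool :=
  [|| K j == [set u; v]%SET, K j == [set u]%SET | K j == [set v]%SET].

Definition has_marked_triangle (n : nat) (K : {ffun 'I_n -> {set 'I_n}}) :
    Prop :=
  exists u v w j1 j2 j3 : 'I_n,
    [/\ uniq [:: u; v; w], uniq [:: j1; j2; j3], marks_edge K j1 u v,
        marks_edge K j2 v w & marks_edge K j3 w u].

(* Main.v *)
Require Import Defs.
From mathcomp Require Import all_boot all_order all_fingroup all_algebra.
From mathcomp Require Import all_classical all_reals all_analysis.
From mathcomp Require Import complex ring lra.

(** Both sides of the equivalence say that the two permutations s and p at the
ends of the edge dual to C have opposite signs.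

Geometry.  If w lies in the relative interior of the cone dual to the edge
conv(s, p), then among the monomials of the determinant only those of s and p
have minimal w-weight.  At a matrix of Puiseux series whose valuation is close
to w, the coefficient of the determinant at its lowest possible exponent is
therefore made of one or both of two terms, sgn(s) and sgn(p) times products of
leading coefficients.  When all leading coefficients are positive and the signs
agree, these terms cannot cancel, so no positive singular matrix has valuation near w ([trop_positive_same_sign]).  When the
signs differ, cancellation can be arranged with all leading coefficients equal
to 1, and one row can then be corrected so that the determinant vanishes
exactly ([singular_lift]); rational points are dense in the hyperplane where s
and p have equal weight, so the whole cone is positive
([edge_cone_sub_trop]).  Ignoring positivity, the same construction shows that
every edge cone lies in the tropical determinant, whereas a weight with a
unique minimal permutation does not; together with an extremal choice of s and
p this identifies the maximal cones with cones of edges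
([maximal_cone_edge]).

Combinatorics.  Placing the marking s(x) at x, the cartoon becomes the picture
of the permutation g = s p^-1 of the nodes: that marking sits on the edge from
x to g(x), or on the node x if g fixes x.  Three distinct markings on the
sides of a triangle force g to permute its vertices, acting either trivially
or as a 3-cycle; with at most one further node, g is even
([marked_triangle_same_sign]).  Conversely the only even nontrivial cycles on
at most four nodes are 3-cycles, which draw a marked triangle
([same_sign_marked_triangle]). *)

Set Implicit Arguments.
Unset Strict Implicit.
Unset Printing Implicit Defensive.

Import Order.TTheory GRing.Theory Num.Theory.
Import numFieldNormedType.Exports.

Local Open Scope classical_set_scope.
Local Open Scope ring_scope.

(** * Initial coefficients of Puiseux series *)

(** The coefficient c is allowed to vanish, so that a is only a lower bound for
the valuation; this makes the relation stable under sums with no condition on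
cancellations. *)
Definition starts_at (F : comNzRingType) (f : puiseux F) (a : rat) (c : F) :=
  (forall r, r < a -> f r = 0) /\ f a = c.

Section StartsAt.
Variable F : comNzRingType.
Implicit Types (f g : puiseux F) (a b q : rat) (c d : F).

Lemma starts_at0 a : starts_at (0 : puiseux F) a 0.
Proof. by []. Qed.

Lemma starts_at_lower f a b c : starts_at f b c -> a < b -> starts_at f a 0.
Proof.
by move=> [fb _] ab; split=> [r ra|]; apply: fb => //; apply: lt_trans ab.
Qed.

Lemma starts_atD f g a c d :
  starts_at f a c -> starts_at g a d -> starts_at (f + g) a (c + d).
Proof.
by move=> [f0 <-] [g0 <-]; split=> // r ra /=; rewrite f0// g0// addr0.
Qed.

Lemma starts_atN f a c : starts_at f a c -> starts_at (- f) a (- c).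
Proof. by move=> [f0 <-]; split=> // r ra /=; rewrite f0// oppr0. Qed.

Lemma starts_at_sum (I : finType) (f : I -> puiseux F) a (c : I -> F) :
  (forall i, starts_at (f i) a (c i)) ->
  starts_at (\sum_i f i) a (\sum_i c i).
Proof.
move=> fc; elim: (index_enum I) => [|i s IH].
  by rewrite !big_nil; exact: starts_at0.
by rewrite !big_cons; exact: starts_atD.
Qed.

Lemma starts_atM f g a b c d :
  starts_at f a c -> starts_at g b d -> starts_at (f * g) (a + b) (c * d).
Proof.
move=> [f0 <-] [g0 <-]; split=> [r rab|].
  apply/eqP/negPn/negP => /cauchy_coef_neq0[x fx gx].
  have ax : a <= x by rewrite leNgt; apply: contraNN fx => /f0 ->.
  have bx : b <= r - x by rewrite leNgt; apply: contraNN gx => /g0 ->.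
  by have := lerD ax bx; rewrite [x + _]addrC subrK leNgt rab.
rewrite [LHS](@cauchy_coefE _ _ _ _ [:: a])//.
  by rewrite big_seq1 [a + b]addrC addrK.
move=> x fx gx; rewrite inE eq_le.
rewrite [a <= x]leNgt (contraNN _ fx) ?andbT => [|/f0->//].
rewrite leNgt (contraNN _ gx)// => ax; rewrite g0//.
by rewrite ltrBlDl ltrD2r.
Qed.

Lemma starts_at1 : starts_at (1 : puiseux F) 0 1.
Proof. by split=> [r r0|] /=; rewrite ?eqxx// lt_eqF. Qed.

Lemma starts_at_prod (I : finType) (f : I -> puiseux F) (a : I -> rat)
    (c : I -> F) : (forall i, starts_at (f i) (a i) (c i)) ->
  starts_at (\prod_i f i) (\sum_i a i) (\prod_i c i).
Proof.
move=> fac; elim: (index_enum I) => [|i s IH].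
  by rewrite !big_nil; exact: starts_at1.
by rewrite !big_cons; exact: starts_atM.
Qed.

Lemma starts_at_sign (b : bool) :
  starts_at ((-1) ^+ b : puiseux F) 0 ((-1) ^+ b).
Proof. by case: b; [exact/starts_atN/starts_at1|exact: starts_at1]. Qed.

Lemma starts_at_pval f a c : starts_at f a c -> c != 0 ->
  [/\ f != 0, Defs.pval f = a & plc f = c].
Proof.
move=> [f0 fa] c0.
have fN0 : f != 0 by apply: contraNneq c0 => f0'; rewrite -fa f0'.
have [lc0 lo] := pvalP fN0.
suff va : Defs.pval f = a by split=> //; rewrite /plc va.
apply/eqP; rewrite eq_le !leNgt; apply/andP; split.
  by apply: contraNN c0 => /lo; rewrite fa => ->.
by apply: contraNN lc0 => /f0; rewrite /plc => ->.
Qed.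

Lemma starts_at_plc f : f != 0 -> starts_at f (Defs.pval f) (plc f).
Proof. by move=> /pvalP[_ lo]; split. Qed.

Lemma puiseux_support_monomial q :
  puiseux_support [set r : rat | (r == q)%:R != 0 :> F].
Proof.
exists `|denq q|%N, (numq q); split=> [|r /=]; first by rewrite absz_gt0 denq_neq0.
have [-> _|] := eqVneq r q; last by rewrite eqxx.
by exists (numq q) => //; rewrite pmulrn absz_denq divq_num_den.
Qed.
Definition monomial q : puiseux F := Puiseux (puiseux_support_monomial q).

Lemma starts_at_monomial q : starts_at (monomial q) q 1.
Proof. by split=> [r rq|] /=; rewrite ?eqxx// lt_eqF. Qed.

End StartsAt.

(** * Weights of permutations and initial terms of determinants *)

Definition perm_weight (V : nmodType) (n : nat) (w : 'M[V]_n) (s : 'S_n) : V :=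
  \sum_i w i (s i).

(** The product over the graph of t starts at the weight of t, so only the
permutations of weight q contribute to the coefficient at exponent q. *)
Lemma starts_at_det (F : comNzRingType) (n : nat) (A : 'M[puiseux F]_n)
    (v : 'M[rat]_n) (c : 'M[F]_n) (q : rat) :
  (forall i j, starts_at (A i j) (v i j) (c i j)) ->
  (forall t, q <= perm_weight v t) ->
  starts_at (\det A) q
    (\sum_(t | perm_weight v t == q) (-1) ^+ t * \prod_i c i (t i)).
Proof.
move=> Ac qmin; rewrite [X in starts_at _ _ X]big_mkcond /=.
apply: starts_at_sum => t.
have /(starts_atM (starts_at_sign F t)) : starts_at (\prod_i A i (t i))
    (perm_weight v t) (\prod_i c i (t i)) by exact: starts_at_prod.
rewrite add0r; case: eqP => [->//|/eqP vtq] /starts_at_lower; apply.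
by rewrite lt_neqAle eq_sym vtq qmin.
Qed.

Lemma perm_neq_ex (T : finType) (s p : {perm T}) :
  s != p -> exists x, s x != p x.
Proof.
move=> sp; apply/existsP; apply: contraNT sp; rewrite negb_exists.
move=> /forallP eq_sp; apply/eqP/permP => x; apply/eqP.
by rewrite -[_ == _]negbK.
Qed.

Section Weight.
Variables (R : realType) (n : nat).
Implicit Types (w : 'M[R]_n) (s t p : 'S_n).

Lemma ratr_perm_weight (v : 'M[rat]_n) t :
  ratr (perm_weight v t) = perm_weight (\matrix_(i, j) ratr (v i j)) t :> R.
Proof.
by rewrite /perm_weight rmorph_sum; apply: eq_bigr => i _; rewrite mxE.
Qed.

Lemma perm_weight_continuous t :
  continuous (fun w : 'M[R]_n => perm_weight w t).
Proof.
rewrite /perm_weight; elim: (index_enum _) => [|i r IH] w.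
  rewrite (_ : (fun w : 'M[R]_n => _) = cst 0); first exact: cst_continuous.
  by apply/funext => u; rewrite big_nil.
rewrite (_ : (fun w : 'M[R]_n => _) = (fun u : 'M[R]_n => u i (t i)) +
    (fun u : 'M[R]_n => \sum_(j <- r) u j (t j))); last first.
  by apply/funext => u; rewrite big_cons.
by apply: continuousD; [exact: coord_continuous|exact: IH].
Qed.

Lemma near_perm_weight_lt w s t : perm_weight w s < perm_weight w t ->
  \forall v \near w, perm_weight v s < perm_weight v t.
Proof.
move=> wst.
pose d (v : 'M[R]_n) := perm_weight v t - perm_weight v s.
have d_cont : {for w, continuous d}.
  by apply: continuousB; exact: perm_weight_continuous.
have d_gt0 : 0 < d w by rewrite subr_gt0.
have := @cvgr_gt _ _ (nbhs w) _ d _ d_cont 0 d_gt0.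
by move=> near_d; near=> v; rewrite -subr_gt0; near: v; exact: near_d.
Unshelve. all: by end_near. Qed.

(** * Weights outside the tropical determinant *)

(** A point of S with valuations close to w has all its minimal permutations in
M, so its determinant starts with a signed sum over some nonempty subset A of
M; if no such sum vanishes, then neither does the determinant. *)
Lemma tropical_det_obstruction w (M : {set 'S_n}) s
    (S : set 'M[puiseux R[i]]_n) :
  S `<=` @det_variety R n -> trop S w -> s \in M ->
  (forall t, t \notin M -> perm_weight w s < perm_weight w t) ->
  (forall z, S z -> (forall i j, z i j != 0) ->
    forall A : {set 'S_n}, A \subset M -> A != finset.set0 ->
    \sum_(t in A) (-1) ^+ t * \prod_i plc (z i (t i)) != 0) ->
  False.
Proof.
move=> Sdet wS sM wlt signs.
have near_lt : \forall u \near w, forall t, t \notin M ->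
    perm_weight u s < perm_weight u t.
  apply: (@filter_forall _ _ (fun t u => t \notin M ->
    perm_weight u s < perm_weight u t) (nbhs w) _) => t.
  have [tM|tM] := boolP (t \in M); first by near=> u.
  by near=> u => _; near: u; exact: near_perm_weight_lt (wlt _ tM).
have [u [[z [Sz z0 uE]] ult]] := wS _ near_lt.
pose v : 'M[rat]_n := \matrix_(i, j) Defs.pval (z i j).
have vu t : ratr (perm_weight v t) = perm_weight u t.
  rewrite ratr_perm_weight uE; congr (perm_weight _ t).
  by apply/matrixP => i j; rewrite !mxE.
have [t0 _ t0min] := @arg_minP _ _ _ s xpredT (fun t => perm_weight v t) erefl.
have zlead i j : starts_at (z i j) (v i j) ((\matrix_(i, j) plc (z i j)) i j).
  by rewrite !mxE; exact: starts_at_plc.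
have [_] := starts_at_det zlead (fun t => t0min t erefl).
rewrite (Sdet z Sz) /= => coef0.
pose A := [set t | perm_weight v t == perm_weight v t0]%SET.
have /negP[] : \sum_(t in A) (-1) ^+ t * \prod_i plc (z i (t i)) != 0.
  apply: signs => //; last by apply/finset.set0Pn; exists t0; rewrite inE.
  apply/fintype.subsetP => t; rewrite inE => /eqP vt.
  by apply: contraT => /ult; rewrite -!vu ltr_rat vt ltNge (t0min s).
apply/eqP; rewrite [RHS]coef0; apply: eq_big => t; first by rewrite inE.
by move=> _; congr (_ * _); apply: eq_bigr => i _; rewrite mxE.
Unshelve. all: by end_near. Qed.

End Weight.

Lemma tropical_det_unique_min (R : realType) (n : nat) (w : 'M[R]_n)
    (s : 'S_n) :
  (forall t, t != s -> perm_weight w s < perm_weight w t) ->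
  ~ @tropical_det R n w.
Proof.
move=> smin w_trop.
apply: (@tropical_det_obstruction _ _ w [set s]%SET s _ _ w_trop) => //.
- by rewrite inE.
- by move=> t; rewrite inE; exact: smin.
move=> z _ z0 A; rewrite finset.subset1 => /orP[]/eqP->; last by rewrite eqxx.
move=> _; rewrite big_set1 mulf_neq0 ?signr_eq0//.
by apply/prodf_neq0 => i _; have [] := pvalP (z0 i (s i)).
Qed.

(** With positive leading coefficients, the initial terms of permutations of
equal sign add up without cancellation. *)
Lemma trop_positive_same_sign (R : realType) (n : nat) (w : 'M[R]_n)
    (s p : 'S_n) : odd_perm s = odd_perm p ->
  (forall t, t != s -> t != p -> perm_weight w s < perm_weight w t) ->
  ~ trop (@det_variety R n `&` @positive_matrices R n) w.
Proof.
move=> sp smin w_trop.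
apply: (@tropical_det_obstruction _ _ w [set s; p]%SET s _ _ w_trop).
- by move=> z [].
- by rewrite !inE eqxx.
- by move=> t; rewrite !inE negb_or => /andP[]; exact: smin.
move=> z [_ zpos] _ A /fintype.subsetP AM /finset.set0Pn[t tA].
rewrite (eq_bigr (fun t : 'S_n => (-1) ^+ s * \prod_i plc (z i (t i)))); last first.
  by move=> u /AM; rewrite !inE => /orP[]/eqP->//; rewrite sp.
rewrite -mulr_sumr mulf_neq0 ?signr_eq0// (bigD1 t)//= gt_eqF//.
rewrite ltr_pwDl ?prodr_gt0// => [i _|]; first exact: zpos.
by apply: sumr_ge0 => u _; apply: prodr_ge0 => i _; apply/ltW/zpos.
Qed.

(** * Singular matrices with prescribed valuations *)

Lemma sum_sign_single (F : comNzRingType) (n : nat) (P : pred 'S_n)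
    (c : 'S_n -> F) (s : 'S_n) : P s -> c s = 1 ->
  (forall t, P t -> t != s -> c t = 0) ->
  \sum_(t | P t) (-1) ^+ t * c t = (-1) ^+ s.
Proof.
move=> Ps cs c0; rewrite (bigD1 s)//= cs mulr1 big1 ?addr0// => t /andP[Pt ts].
by rewrite c0 ?mulr0.
Qed.

(** Start from the matrix y of monomials of valuation v and a row i0 where s and
p differ.  Restricting that row to its entry in column s i0 gives y1, whose
determinant starts with the term of s; deleting this entry instead gives y2,
whose determinant starts with the term of p.  Replacing row i0 of y by
(det y1) (row of y2) - (det y2) (row of y1) makes the determinant vanish
without any division.  Both determinants start at the exponent q, with
coefficients sgn(s) and sgn(p), so the factor u = sgn(s) t^(-q) restores the
valuations v and makes the leading coefficients of the row equal to 1, except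
for - sgn(s) sgn(p) in column s i0. *)
Lemma singular_lift (F : comNzRingType) (n : nat) (v : 'M[rat]_n) (s p : 'S_n) :
  s != p -> perm_weight v s = perm_weight v p ->
  (forall t, t != s -> t != p -> perm_weight v s < perm_weight v t) ->
  exists z : 'M[puiseux F]_n, \det z = 0 /\
    forall i j, exists2 c, starts_at (z i j) (v i j) c &
      c = 1 \/ c = - (-1) ^+ s * (-1) ^+ p.
Proof.
move=> sp vsp vmin; set q := perm_weight v s in vsp vmin.
have [i0 i0sp] := perm_neq_ex sp.
pose j0 := s i0.
pose y := \matrix_(i, j) @monomial F (v i j).
pose c1 : 'M[F]_n := \matrix_(i, j) ((i != i0) || (j == j0))%:R.
pose c2 : 'M[F]_n := \matrix_(i, j) ((i != i0) || (j != j0))%:R.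
pose y1 : 'M[puiseux F]_n :=
  \matrix_(i, j) (if (i != i0) || (j == j0) then y i j else 0).
pose y2 : 'M[puiseux F]_n :=
  \matrix_(i, j) (if (i != i0) || (j != j0) then y i j else 0).
have y1c i j : starts_at (y1 i j) (v i j) (c1 i j).
  by rewrite !mxE; case: ifP => _; [exact: starts_at_monomial|exact: starts_at0].
have y2c i j : starts_at (y2 i j) (v i j) (c2 i j).
  by rewrite !mxE; case: ifP => _; [exact: starts_at_monomial|exact: starts_at0].
have qmin t : q <= perm_weight v t.
  have [->//|ts] := eqVneq t s; have [->|tp] := eqVneq t p; first by rewrite vsp.
  exact/ltW/vmin.
have qargmin t : perm_weight v t == q -> t = s \/ t = p.
  move=> /eqP vt; have [|ts] := eqVneq t s; first by left.
  have [|tp] := eqVneq t p; first by right.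
  by have := vmin t ts tp; rewrite vt ltxx.
have det1 : starts_at (\det y1) q ((-1) ^+ s).
  have := starts_at_det y1c qmin; rewrite (sum_sign_single (s := s))//.
    rewrite big1// => i _; rewrite mxE; have [->|//] := eqVneq i i0.
    by rewrite eqxx.
  move=> t /qargmin[->|-> _]; first by rewrite eqxx.
  by rewrite (bigD1 i0)//= mxE eqxx eq_sym (negPf i0sp) mul0r.
have det2 : starts_at (\det y2) q ((-1) ^+ p).
  have := starts_at_det y2c qmin; rewrite (sum_sign_single (s := p)) ?vsp ?eqxx//.
    rewrite big1// => i _; rewrite mxE; have [->|//] := eqVneq i i0.
    by rewrite eq_sym i0sp.
  rewrite -vsp => t /qargmin[-> _|->]; last by rewrite eqxx.
  by rewrite (bigD1 i0)//= mxE !eqxx mul0r.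
pose u : puiseux F := (-1) ^+ s * monomial F (- q).
have u_start : starts_at u (- q) ((-1) ^+ s).
  rewrite -[- q]add0r -[X in starts_at _ _ X]mulr1.
  exact: starts_atM (starts_at_sign F s) (starts_at_monomial F _).
pose b := u * \det y1; pose c := - (u * \det y2).
pose z : 'M[puiseux F]_n :=
  \matrix_(i, j) (if i == i0 then b * y2 i j + c * y1 i j else y i j).
have b_start : starts_at b 0 1.
  have := starts_atM u_start det1.
  by rewrite addNr -expr2 sqrr_sign.
have c_start : starts_at c 0 (- (-1) ^+ s * (-1) ^+ p).
  have := starts_atN (starts_atM u_start det2).
  by rewrite addNr mulNr.
exists z; split.
  rewrite (@determinant_multilinear _ _ z y2 y1 i0 b c).
  - by rewrite /b /c; ring.
  - by apply/rowP => j; rewrite !mxE eqxx.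
  - by apply/matrixP => i j; rewrite !mxE [lift i0 i == i0]eq_sym (negPf (neq_lift i0 i)).
  - by apply/matrixP => i j; rewrite !mxE [lift i0 i == i0]eq_sym (negPf (neq_lift i0 i)).
move=> i j; rewrite mxE; have [->|ii0] := eqVneq i i0; last first.
  by exists 1; [rewrite mxE; exact: starts_at_monomial|left].
have := starts_atD (starts_atM b_start (y2c i0 j))
  (starts_atM c_start (y1c i0 j)).
rewrite add0r; set d := (X in starts_at _ _ X) => zd; exists d => //.
rewrite /d !mxE eqxx /=; have [_|_] := eqVneq j j0; [right|left].
  by rewrite mulr0 add0r mulr1.
by rewrite mulr0 addr0 mulr1.
Qed.

(** * Cones of edges inside the tropical determinant *)

Section EdgeCone.
Variables (R : realType) (n : nat).
Implicit Types (w : 'M[R]_n) (s t p : 'S_n).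

(** Equality of two weights is a linear equation with integer coefficients:
approximate all entries of w by rationals, then solve for one of them. *)
Lemma rational_dense_equal_weight w s p (B : set 'M[R]_n) : s != p ->
  perm_weight w s = perm_weight w p -> nbhs w B ->
  exists v : 'M[rat]_n, perm_weight v s = perm_weight v p /\
    B (\matrix_(i, j) ratr (v i j)).
Proof.
move=> sp wsp /nbhs_ballP[e /= e0 eB].
have [i0 i0sp] := perm_neq_ex sp.
(* The entry solved for below accumulates less than 2n errors of size d. *)
pose d := e / (2 * (n%:R + 1)).
have n0 : 0 < 2 * (n%:R + 1) :> R by rewrite mulr_gt0// ltr_pwDr.
have d0 : 0 < d by rewrite divr_gt0.
have de : d *+ n + d *+ n < e.
  have eE : d * (2 * (n%:R + 1)) = e by rewrite divfK// gt_eqF.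
  by rewrite -mulr_natr; lra.
have [r rP] : exists r : 'M[rat]_n, forall i j, `|w i j - ratr (r i j)| < d.
  have approx x : exists q : rat, `|x - ratr q| < d.
    have [|q] := @rat_in_itvoo R (x - d) (x + d); first by lra.
    rewrite in_itv /= => /andP[xq qx]; exists q; rewrite ltr_norml.
    by apply/andP; split; lra.
  exists (\matrix_(i, j) sval (cid (approx (w i j)))) => i j.
  by rewrite mxE; case: cid.
(* The entry at (i0, s i0) is free to absorb the error, since p avoids it. *)
pose x := perm_weight r p - \sum_(i | i != i0) r i (s i).
pose v : 'M[rat]_n :=
  \matrix_(i, j) (if (i == i0) && (j == s i0) then x else r i j).
exists v; split.
  rewrite /perm_weight (bigD1 i0)//= mxE !eqxx /= (eq_bigr (fun i => r i (s i))).
    rewrite subrK; apply: eq_bigr => i _; rewrite mxE.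
    by case: eqP => [->|//]; rewrite eq_sym (negPf i0sp).
  by move=> i /negPf ii0; rewrite mxE ii0.
apply: eB; split=> // i j; rewrite !mxE /ball /=.
case: ifP => [/andP[/eqP-> /eqP->]|_]; last first.
  apply: lt_le_trans (rP i j) _; apply: le_trans (ltW de).
  have n_gt0 : (0 < n)%N by apply: leq_ltn_trans (ltn_ord i0).
  rewrite -mulr_natr; have : 1 <= n%:R :> R by rewrite ler1n.
  by nra.
have -> : w i0 (s i0) - ratr x =
    \sum_i (w i (p i) - ratr (r i (p i))) -
    \sum_(i | i != i0) (w i (s i) - ratr (r i (s i))).
  move: wsp; rewrite /perm_weight [X in X = _](bigD1 i0)//= => wsp.
  by rewrite !sumrB -wsp /x /perm_weight rmorphB !rmorph_sum /=; ring.
apply: le_lt_trans de; apply: le_trans (ler_normB _ _) _; apply: lerD.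
  apply: le_trans (ler_norm_sum _ _ _) _.
  rewrite -[n in _ *+ n]card_ord -sumr_const.
  by apply: ler_sum => k _; exact/ltW.
apply: le_trans (ler_norm_sum _ _ _) _.
rewrite -[n in _ *+ n]card_ord -sumr_const big_mkcond; apply: ler_sum => k _.
by case: ifP => _; [exact/ltW|exact/ltW].
Qed.

(** A weight that vanishes exactly on the permutations lying entrywise between s
and p.  When these are just s and p, it exposes conv(s, p) as a face, and adding
a small multiple of it moves a point of the cone dual to this edge into the
relative interior. *)
Definition off_support s p : 'M[R]_n :=
  \matrix_(i, j) ((j != s i) && (j != p i))%:R.

Lemma off_support_ge0 s p t : 0 <= perm_weight (off_support s p) t.
Proof. by apply: sumr_ge0 => i _; rewrite mxE ler0n. Qed.

Lemma off_support_eq0 s p t : (perm_weight (off_support s p) t == 0) =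
  [forall i, (t i == s i) || (t i == p i)].
Proof.
rewrite psumr_eq0 => [|i _]; last by rewrite mxE ler0n.
apply/allP/forallP => [t0 i|ti i _]; last first.
  by rewrite /= mxE pnatr_eq0 eqb0 negb_and !negbK ti.
have := t0 i (mem_index_enum i).
by rewrite /= mxE pnatr_eq0 eqb0 negb_and !negbK.
Qed.

Lemma off_support_argmin s p :
  (forall t, [forall i, (t i == s i) || (t i == p i)] -> t = s \/ t = p) ->
  [/\ perm_weight (off_support s p) s = 0, perm_weight (off_support s p) p = 0
    & forall t, t != s -> t != p -> 0 < perm_weight (off_support s p) t].
Proof.
move=> between; split.
- by apply/eqP; rewrite off_support_eq0; apply/forallP => i; rewrite eqxx.
- by apply/eqP; rewrite off_support_eq0; apply/forallP => i; rewrite eqxx orbT.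
move=> t ts tp; rewrite lt0r off_support_ge0 andbT off_support_eq0.
by apply/negP => /between[] tE; rewrite tE eqxx in ts tp.
Qed.

Lemma perm_weightDZ w u (a : R) t :
  perm_weight (w + a *: u) t = perm_weight w t + a * perm_weight u t.
Proof.
rewrite /perm_weight mulr_sumr -big_split.
by apply: eq_bigr => i _; rewrite !mxE.
Qed.

(** Perturbing w into the relative interior of the cone and then to a nearby
rational point gives a weight to lift to a singular matrix. *)
Lemma edge_cone_sub_trop w s p : s != p ->
  (forall t, [forall i, (t i == s i) || (t i == p i)] -> t = s \/ t = p) ->
  perm_weight w s = perm_weight w p ->
  (forall t, perm_weight w s <= perm_weight w t) ->
  trop [set z | @det_variety R n z /\
    (odd_perm s != odd_perm p -> @positive_matrices R n z)] w.
Proof.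
move=> sp between wsp wmin; set S := (X in trop X).
have perturbed a : 0 < a -> trop S (w + a *: off_support s p).
  move=> a0; set w' := w + _.
  have [s0 p0 off_gt0] := off_support_argmin between.
  have w'sp : perm_weight w' s = perm_weight w' p.
    by rewrite !perm_weightDZ s0 p0 wsp.
  have w'min t : t != s -> t != p -> perm_weight w' s < perm_weight w' t.
    move=> ts tp; rewrite !perm_weightDZ s0 mulr0 addr0.
    by apply: le_lt_trans (wmin t) _; rewrite ltrDl mulr_gt0// off_gt0.
  move=> B B_nbhs.
  have strict_nbhs : \forall u \near w', forall t,
      t != s -> t != p -> perm_weight u s < perm_weight u t.
    apply: (@filter_forall _ _ (fun t u => t != s -> t != p ->
      perm_weight u s < perm_weight u t) (nbhs w') _) => t.
    have [->|ts] := eqVneq t s; first by near=> u.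
    have [->|tp] := eqVneq t p; first by near=> u.
    by near=> u => _ _; near: u; exact: near_perm_weight_lt (w'min _ ts tp).
  have [v [vsp [vB vmin]]] :=
    rational_dense_equal_weight sp w'sp (filterI B_nbhs strict_nbhs).
  have [|z [z_det zv]] := @singular_lift R[i] n v s p sp vsp.
    by move=> t ts tp; have := vmin t ts tp; rewrite -!ratr_perm_weight ltr_rat.
  exists (\matrix_(i, j) ratr (v i j)); split=> //; exists z.
  have z_lead i j : [/\ z i j != 0, Defs.pval (z i j) = v i j &
      odd_perm s != odd_perm p -> plc (z i j) = 1].
    have [c zc cE] := zv i j.
    have c0 : c != 0.
      by case: cE => ->; rewrite ?oner_eq0// mulf_neq0 ?oppr_eq0 ?signr_eq0.
    have [z0 -> ->] := starts_at_pval zc c0; split=> // signs.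
    case: cE => // ->; move: signs.
    by case: (odd_perm s) (odd_perm p) => -[] // _; rewrite ?expr0 ?expr1; ring.
  split.
  - split=> // /[dup] signs _ i j; rewrite /ppos.
    by have [_ _ ->] := z_lead i j.
  - by move=> i j; have [] := z_lead i j.
  - by apply/matrixP => i j; rewrite !mxE; have [_ -> _] := z_lead i j.
apply: closed_closure => B /nbhs_ballP[e /= e0 eB].
have e2 : 0 < e / 2 by rewrite divr_gt0.
exists (w + (e / 2) *: off_support s p); split; first exact: perturbed.
apply: eB; split=> // i j; rewrite !mxE /ball /= opprD addrA subrr add0r normrN.
rewrite normrM gtr0_norm// normr_nat; case: (_ && _); rewrite ?mulr0// mulr1.
by lra.
Unshelve. all: by end_near. Qed.
End EdgeCone.

(** * Edges of the Birkhoff polytope and their normal cones *)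

Section Convex.
Variables (R : realType) (n : nat).
Implicit Types (w x : 'M[R]_n) (s t p : 'S_n).

Lemma mxdot_perm_mx w t : mxdot w (perm_mx t) = perm_weight w t.
Proof.
apply: eq_bigr => i _; rewrite (bigD1 (t i))//= big1 => [|j tij].
  by rewrite !mxE eqxx mulr1 addr0.
by rewrite !mxE eq_sym (negPf tij) mulr0.
Qed.

Lemma mxdot_convex w (k : nat) (l : 'I_k -> R) (q : 'I_k -> 'M[R]_n) :
  mxdot w (\sum_i l i *: q i) = \sum_i l i * mxdot w (q i).
Proof.
rewrite /mxdot [RHS](eq_bigr (fun i => \sum_a \sum_b l i * (w a b * q i a b))).
  rewrite [RHS]exchange_big; apply: eq_bigr => a _ /=.
  rewrite [RHS]exchange_big; apply: eq_bigr => b _ /=.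
  rewrite summxE mulr_sumr; apply: eq_bigr => i _.
  by rewrite mxE mulrCA.
by move=> i _; rewrite mulr_sumr; apply: eq_bigr => a _; rewrite mulr_sumr.
Qed.

Lemma convex_hull_mxdot_ge w (A : set 'M[R]_n) (c : R) x :
  (forall a, A a -> c <= mxdot w a) -> convex_hull A x -> c <= mxdot w x.
Proof.
move=> cA [k [l [q [qA l0 l1 ->]]]]; rewrite mxdot_convex.
rewrite -[c]mul1r -l1 mulr_suml; apply: ler_sum => i _.
by rewrite ler_wpM2l// cA.
Qed.

Lemma convex_hull_mxdot_eq w (A : set 'M[R]_n) (c : R) x :
  (forall a, A a -> mxdot w a = c) -> convex_hull A x -> mxdot w x = c.
Proof.
move=> cA [k [l [q [qA l0 l1 ->]]]]; rewrite mxdot_convex.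
rewrite -[RHS]mul1r -l1 mulr_suml; apply: eq_bigr => i _.
by rewrite cA.
Qed.

Lemma sub_convex_hull (A : set 'M[R]_n) : A `<=` convex_hull A.
Proof.
move=> a Aa; exists 1%N, (fun=> 1), (fun=> a).
by rewrite !big_ord_recl !big_ord0 !addr0 scale1r; split=> // i; rewrite ler01.
Qed.

Lemma convex_hull_mono (A B : set 'M[R]_n) :
  A `<=` B -> convex_hull A `<=` convex_hull B.
Proof.
move=> AB x [k [l [q [qA l0 l1 ->]]]].
by exists k, l, q; split=> // i; exact: AB.
Qed.

Lemma birkhoff_perm t : @birkhoff R n (perm_mx t).
Proof. by apply: sub_convex_hull; exists t. Qed.

Lemma perm_segment_sub s p : @perm_segment R n s p `<=` @birkhoff R n.
Proof. by apply: convex_hull_mono => x [] ->; [exists s|exists p]. Qed.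

Lemma birkhoff_mxdot_ge w (c : R) x : (forall t, c <= perm_weight w t) ->
  @birkhoff R n x -> c <= mxdot w x.
Proof.
by move=> cw; apply: convex_hull_mxdot_ge => _ [t _ <-]; rewrite mxdot_perm_mx.
Qed.

Lemma perm_segment_ends s p : @perm_segment R n s p (perm_mx s) /\
  @perm_segment R n s p (perm_mx p).
Proof. by split; apply: sub_convex_hull; [left|right]. Qed.

Lemma normal_cone_perm_segment w s p :
  normal_cone (@birkhoff R n) (@perm_segment R n s p) w <->
  perm_weight w s = perm_weight w p /\
  forall t, perm_weight w s <= perm_weight w t.
Proof.
have [ss pp] := perm_segment_ends s p; split=> [wN|[wsp wmin] x y Fx Py].
  have wmin t : perm_weight w s <= perm_weight w t.
    by rewrite -!mxdot_perm_mx; apply: wN => //; exact: birkhoff_perm.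
  split=> //; apply/eqP; rewrite eq_le wmin -!mxdot_perm_mx.
  by apply: wN => //; exact: birkhoff_perm.
rewrite (convex_hull_mxdot_eq (c := perm_weight w s) _ Fx).
  exact: birkhoff_mxdot_ge.
by move=> _ [] ->; rewrite mxdot_perm_mx.
Qed.

Lemma argmin_face_perm_segment w s p :
  perm_weight w s = perm_weight w p ->
  (forall t, t != s -> t != p -> perm_weight w s < perm_weight w t) ->
  face_of (@birkhoff R n) (@perm_segment R n s p).
Proof.
move=> wsp wlt; exists w.
have wmin t : perm_weight w s <= perm_weight w t.
  have [->//|ts] := eqVneq t s; have [->|tp] := eqVneq t p; first by rewrite wsp.
  exact/ltW/wlt.
apply/seteqP; split=> [x Fx|x [[k [l [q [qA l0 l1 ->]]]]]].
  split; first exact: perm_segment_sub Fx.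
  by move=> y Py; have /normal_cone_perm_segment := conj wsp wmin; apply.
move=> /(_ _ (birkhoff_perm s)); rewrite mxdot_perm_mx mxdot_convex => wx.
(* A convex combination attaining the minimum uses minimizers only. *)
have slack0 i : l i * (mxdot w (q i) - perm_weight w s) = 0.
  have slack_ge0 j : 0 <= l j * (mxdot w (q j) - perm_weight w s).
    rewrite mulr_ge0// subr_ge0; have [t _ <-] := qA j.
    by rewrite mxdot_perm_mx.
  apply/eqP; have : \sum_i l i * (mxdot w (q i) - perm_weight w s) == 0.
    rewrite eq_le sumr_ge0// andbT.
    under eq_bigr do rewrite mulrBr.
    by rewrite sumrB -mulr_suml l1 mul1r subr_le0.
  by rewrite psumr_eq0// => /allP /(_ i (mem_index_enum i)).
(* Points of weight 0 in the combination are arbitrary; s replaces them. *)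
exists k, l, (fun i => if l i == 0 then perm_mx s else q i).
split=> // [i|]; last first.
  by apply: eq_bigr => i _; case: eqP => // ->; rewrite !scale0r.
case: eqVneq => [_|li0]; first by left.
have /eqP := slack0 i; rewrite mulf_eq0 (negPf li0) subr_eq0 /=.
have [t _ <-] := qA i; rewrite mxdot_perm_mx => /eqP wt.
have [->|ts] := eqVneq t s; first by left.
have [->|tp] := eqVneq t p; first by right.
by have := wlt t ts tp; rewrite wt ltxx.
Qed.

Lemma perm_segment_vertex s p t : @perm_segment R n s p (perm_mx t) ->
  t = s \/ t = p.
Proof.
move=> Ft; apply: contrapT => /not_orP[/eqP ts /eqP tp].
(* This weight counts the points where a permutation differs from t. *)
pose w := off_support R t t.
pose c := Num.min (perm_weight w s) (perm_weight w p).
have w_gt0 u : t != u -> 0 < perm_weight w u.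
  move=> tu; rewrite lt0r off_support_ge0 andbT off_support_eq0.
  apply: contraNN tu => /forallP ut; apply/eqP/permP => i.
  by have /orP[] := ut i => /eqP.
have c_gt0 : 0 < c by rewrite lt_min !w_gt0.
have : c <= mxdot w (perm_mx t).
  apply: convex_hull_mxdot_ge Ft => _ [] ->.
    by rewrite mxdot_perm_mx ge_min lexx.
  by rewrite mxdot_perm_mx ge_min lexx orbT.
suff -> : mxdot w (perm_mx t) = 0 by rewrite leNgt c_gt0.
apply/eqP; rewrite mxdot_perm_mx off_support_eq0.
by apply/forallP => i; rewrite eqxx.
Qed.

Lemma birkhoff_edge_argmin s p : birkhoff_edge R s p ->
  exists2 w, normal_cone (@birkhoff R n) (@perm_segment R n s p) w &
    forall t, t != s -> t != p -> perm_weight w s < perm_weight w t.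
Proof.
move=> [_ [w Fw]]; exists w.
  by move=> x y; rewrite Fw => -[_ xmin]; exact: xmin.
have [Fs _] := perm_segment_ends s p; move: Fs; rewrite Fw => -[_ smin] t ts tp.
rewrite lt_neqAle -!mxdot_perm_mx.
rewrite (smin _ (birkhoff_perm t)) andbT; apply/eqP => wst.
have [] : t = s \/ t = p; last 2 first.
- by move=> tE; rewrite tE eqxx in ts.
- by move=> tE; rewrite tE eqxx in tp.
apply: perm_segment_vertex; rewrite Fw; split; first exact: birkhoff_perm.
by move=> y Py; rewrite -wst; exact: smin.
Qed.

End Convex.

(** * Marked triangles on at most four nodes *)

Section Cartoon.
Variable n : nat.
Implicit Types (s t p g : 'S_n) (u v w x : 'I_n).

Lemma cartoonE s p x :
  cartoon s p (s x) = [set x; (s * p^-1)%g x]%SET.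
Proof.
rewrite ffunE permK permM; case: eqVneq => [<-|//].
by apply/setP => y; rewrite !inE orbb.
Qed.

Lemma marks_edgeP s p x u v : marks_edge (cartoon s p) (s x) u v =
  (x \in [set u; v]%SET) && ((s * p^-1)%g x \in [set u; v]%SET).
Proof.
rewrite /marks_edge cartoonE; set y := (s * p^-1)%g x.
apply/idP/andP => [/or3P[]/eqP xy|[]].
- by rewrite -xy !inE !eqxx orbT.
- have : x \in [set x; y]%SET /\ y \in [set x; y]%SET by rewrite !inE !eqxx orbT.
  by rewrite xy !inE => -[-> ->].
- have : x \in [set x; y]%SET /\ y \in [set x; y]%SET by rewrite !inE !eqxx orbT.
  by rewrite xy !inE => -[-> ->]; rewrite !orbT.
rewrite !inE => /orP[]/eqP-> /orP[]/eqP->; rewrite ?finset.setUid ?eqxx ?orbT//.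
by rewrite [X in X == _]finset.setUC eqxx.
Qed.

(** Injectivity leaves only two possibilities on {u, v, w}: either g fixes the
three points, or it rotates them.  The at most one remaining point is fixed. *)
Lemma even_perm_of_triangle g u v w : (n <= 4)%N -> uniq [:: u; v; w] ->
  g u \in [set u; v]%SET -> g v \in [set v; w]%SET -> g w \in [set w; u]%SET ->
  odd_perm g = false.
Proof.
move=> n4 uniq_uvw; have := uniq_uvw; rewrite /= !inE negb_or !andbT.
move=> /andP[/andP[uv uw] vw] gu gv gw.
have gI x y : (g x == g y) = (x == y) by rewrite (inj_eq perm_inj).
have g_cases : [/\ g u = u, g v = v & g w = w] \/
    [/\ g u = v, g v = w & g w = u].
  move: (gI u v) (gI u w) (gI v w) gu gv gw.
  rewrite (negPf uv) (negPf uw) (negPf vw).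
  move=> guv guw gvw /orP[]/eqP gu; rewrite gu in guv guw *.
    move=> gv /orP[]/eqP gw; rewrite gw ?eqxx in guw gvw *; last by [].
    by move: gv gvw => /orP[]/eqP->; rewrite ?eqxx//; left.
  move=> /orP[]/eqP gv; rewrite gv ?eqxx in guv gvw *; first by [].
  by move=> /orP[]/eqP gw; rewrite gw ?eqxx in gvw *; [|right].
have g_fix x : x \notin [:: u; v; w] -> g x = x.
  move=> xT; apply: contraTeq isT => gx; exfalso.
  have gxT : g x \notin [:: u; v; w].
    move: xT; rewrite !inE !negb_or => /and3P[xu xv xw]; apply/and3P.
    case: g_cases => -[gu' gv' gw']; split.
    - by rewrite -gu' gI.
    - by rewrite -gv' gI.
    - by rewrite -gw' gI.
    - by rewrite -gw' gI.
    - by rewrite -gu' gI.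
    - by rewrite -gv' gI.
  have : uniq [:: g x, x & [:: u; v; w]].
    by rewrite [uniq _]/= inE negb_or gx gxT xT.
  move=> /card_uniqP /= c5; have := max_card (mem [:: g x, x & [:: u; v; w]]).
  by rewrite c5 card_ord => /leq_trans /(_ n4).
case: g_cases => -[gu' gv' gw'].
  suff -> : g = 1%g by rewrite odd_perm1.
  apply/permP => x; rewrite perm1.
  have [|/g_fix//] := boolP (x \in [:: u; v; w]).
  by rewrite !inE => /or3P[]/eqP->.
suff -> : g = (tperm u v * tperm u w)%g by rewrite odd_permM !odd_tperm uv uw.
apply/permP => x; rewrite permM.
have [|xT] := boolP (x \in [:: u; v; w]).
  rewrite !inE => /or3P[]/eqP->.
  - by rewrite tpermL tpermD// eq_sym.
  - by rewrite tpermR tpermL.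
  - by rewrite [tperm u v w]tpermD// tpermR.
rewrite g_fix//; move: xT; rewrite !inE !negb_or => /and3P[xu xv xw].
by rewrite !tpermD // eq_sym.
Qed.

Lemma marked_triangle_same_sign s p : (n <= 4)%N ->
  has_marked_triangle (cartoon s p) -> odd_perm s = odd_perm p.
Proof.
move=> n4 [u [v [w [j1 [j2 [j3 [uvw]]]]]]].
rewrite -[j1](permKV s) -[j2](permKV s) -[j3](permKV s) !marks_edgeP.
move: (s^-1 j1)%g (s^-1 j2)%g (s^-1 j3)%g => x y z.
set g := (s * p^-1)%g.
rewrite /= !inE !(inj_eq perm_inj) negb_or => /and3P[/andP[xy xz] yz _].
move=> mark_x mark_y mark_z.
suff g_even : odd_perm g = false.
  have := g_even; rewrite /g odd_permM odd_permV.
  by case: (odd_perm s) (odd_perm p) => -[].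
have := uvw; rewrite /= !inE negb_or => /and3P[/andP[uv uw] vw _].
(* Each of x, y, z is one of u, v, w; distinctness leaves (u, v, w) and
   (v, w, u), and the second is the first with u and v exchanged. *)
case/andP: mark_x => /orP[]/eqP xE gx; case/andP: mark_y => /orP[]/eqP yE gy;
  case/andP: mark_z => /orP[]/eqP zE gz;
  rewrite {x}xE {y}yE {z}zE ?eqxx// in xy xz yz gx gy gz.
- by apply: (even_perm_of_triangle n4 uvw); rewrite !inE.
- have vuw : uniq [:: v; u; w] by rewrite /= !inE negb_or eq_sym uv vw uw.
  by apply: (even_perm_of_triangle n4 vuw); rewrite !inE orbC.
Qed.

(** The hypothesis on permutations between s and p says that g = s p^-1 is a
single cycle.  On at most four nodes its length is 2, 3 or 4, and the sign leaves 3. *)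
Lemma same_sign_marked_triangle s p : (n <= 4)%N -> s != p ->
  (forall t, [forall i, (t i == s i) || (t i == p i)] -> t = s \/ t = p) ->
  odd_perm s = odd_perm p -> has_marked_triangle (cartoon s p).
Proof.
move=> n4 sp between sign; pose g := (s * p^-1)%g.
have [u gu] : exists u, g u != u.
  have [u su] := perm_neq_ex sp; exists u; apply: contraNneq su => gu.
  by rewrite -{2}gu permM permKV.
have g_even : odd_perm g = false by rewrite odd_permM odd_permV sign addbb.
have pg x : p (g x) = s x by rewrite permM permKV.
pose v := g u; pose w := g v.
have gI x y : (g x == g y) = (x == y) by rewrite (inj_eq perm_inj).
have uv : u != v by rewrite eq_sym.
have vw : v != w by rewrite gI.
have uw : u != w.
  apply/eqP => uw.
  (* Composing s with the transposition of u and v stays between s and p. *)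
  have [] := between (tperm u v * s)%g.
  - apply/forallP => x; rewrite permM; case: tpermP => [->|->|_ _]; last by rewrite eqxx.
      by rewrite -(pg v) -/w -uw eqxx orbT.
    by rewrite -(pg u) eqxx orbT.
  - move=> /permP/(_ u); rewrite permM tpermL => /perm_inj vu.
    by rewrite vu eqxx in uv.
  - move=> tp; have := g_even.
    by rewrite odd_permM odd_permV -tp odd_permM odd_tperm uv; case: (odd_perm s).
(* Otherwise g would be a 4-cycle, hence odd. *)
have gw : g w = u.
  apply: contraTeq isT => gwu; exfalso.
  have wgw : w != g w by rewrite gI.
  have vgw : v != g w by rewrite gI.
  have uniq4 : uniq [:: u; v; w; g w].
    by rewrite /= !inE !negb_or uv uw vw vgw wgw [u == _]eq_sym gwu.
  have all4 x : x \in [:: u; v; w; g w].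
    apply: contraTT n4 => x4; rewrite -ltnNge -[n]card_ord.
    have /card_uniqP /= <- : uniq (x :: [:: u; v; w; g w]).
      by rewrite [uniq _]/= x4.
    exact: max_card.
  have ggw : g (g w) = u.
    apply/eqP; have := all4 (g (g w)); rewrite !inE => /or4P[//|||].
    - by rewrite (gI (g w) u : (g (g w) == v) = _) (negPf gwu).
    - by rewrite (gI (g w) v : (g (g w) == w) = _) eq_sym (negPf vgw).
    - by rewrite (gI (g w) w : (g (g w) == g w) = _) eq_sym (negPf wgw).
  have gE : g = (tperm u v * (tperm u w * tperm u (g w)))%g.
    have [vu wu wv] : [/\ v != u, w != u & w != v].
      by rewrite ![_ == u]eq_sym [w == v]eq_sym.
    have [gwv gww ugw] : [/\ g w != v, g w != w & u != g w].
      by rewrite [u == _]eq_sym ![g w == _]eq_sym; split=> //; rewrite eq_sym.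
    apply/permP => x; rewrite 2![RHS]permM; have := all4 x.
    rewrite !inE => /or4P[]/eqP->.
    - by rewrite tpermL [tperm u w v]tpermD// tpermD.
    - by rewrite tpermR tpermL tpermD.
    - by rewrite [tperm u v w]tpermD// tpermR tpermL.
    - by rewrite [tperm u v _]tpermD// [tperm u w _]tpermD// tpermR.
  by have := g_even; rewrite gE !odd_permM !odd_tperm uv uw eq_sym gwu.
exists u, v, w, (s u), (s v), (s w); split.
- by rewrite /= !inE negb_or uv uw vw.
- by rewrite /= !inE negb_or !(inj_eq (@perm_inj _ s)) uv uw vw.
- by rewrite marks_edgeP !inE -/g -/v !eqxx orbT.
- by rewrite marks_edgeP !inE -/g -/w !eqxx orbT.
- by rewrite marks_edgeP !inE -/g gw !eqxx orbT.
Qed.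
End Cartoon.

Lemma trop_subset (R : realType) (m n : nat)
    (S T : set 'M[puiseux R[i]]_(m, n)) :
  S `<=` T -> trop S `<=` trop T.
Proof.
move=> ST; apply: closureS => w [z [Sz z0 ->]].
by exists z; split=> //; exact: ST.
Qed.

(** * Maximal cones are cones of edges *)

Section MinimalPair.
Variables (R : realType) (n : nat).
Implicit Types (w : 'M[R]_n) (s t p : 'S_n).

(** Where t follows s let t' follow p, and conversely; this gives
a permutation t' with perm_mx t + perm_mx t' = perm_mx s + perm_mx p. *)
Lemma between_complement s p t : [forall i, (t i == s i) || (t i == p i)] ->
  exists t' : 'S_n,
    forall w, perm_weight w t + perm_weight w t' =
      perm_weight w s + perm_weight w p.
Proof.
move=> /forallP between; pose f i := if t i == s i then p i else s i.
have f_inj : injective f.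
  (* The preimage of the common value under t can be neither i nor k. *)
  have mixed i k : t i == s i -> t k != s k -> p i = s k -> i = k.
    move=> /eqP ti tk pisk; have := between k; rewrite (negPf tk) /= => /eqP tkp.
    have := between (t^-1 (p i))%g; rewrite permKV pisk (inj_eq perm_inj).
    case/orP => /eqP e.
      by move: tk; rewrite {1}e permKV eqxx.
    move: e; rewrite -pisk => /perm_inj e.
    have : t i = p i by rewrite {1}e permKV.
    by rewrite ti pisk => /perm_inj.
  move=> i k; rewrite /f; case: ifPn => ti; case: ifPn => tk.
  - exact: perm_inj.
  - exact: mixed.
  - by move=> /esym/mixed -> .
  - exact: perm_inj.
exists (perm f_inj) => w.
rewrite /perm_weight -!big_split; apply: eq_bigr => i _ /=.
rewrite permE /f; case: ifPn => [/eqP-> //|ti].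
by have := between i; rewrite (negPf ti) => /eqP ->; rewrite addrC.
Qed.

(** Among the pairs of distinct minimizers take one that differs at the fewest
points.  A permutation t between s and p is again a minimizer, because its
complement has at least the minimal weight; if t were distinct from s and p,
the pair (s, t) would differ at fewer points. *)
Lemma minimal_argmin_pair w s0 p0 : s0 != p0 ->
  (forall t, perm_weight w s0 <= perm_weight w t) ->
  (forall t, perm_weight w p0 <= perm_weight w t) ->
  exists s p, [/\ s != p, forall t, perm_weight w s <= perm_weight w t,
    perm_weight w s = perm_weight w p &
    forall t, [forall i, (t i == s i) || (t i == p i)] -> t = s \/ t = p].
Proof.
move=> sp0 smin0 pmin0; pose m := perm_weight w s0.
pose good (x : 'S_n * 'S_n) :=
  [&& x.1 != x.2, perm_weight w x.1 == m & perm_weight w x.2 == m].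
pose moved (x : 'S_n * 'S_n) := [set i | x.1 i != x.2 i]%SET.
have good0 : good (s0, p0).
  by rewrite /good sp0 /= eqxx eq_le smin0 pmin0.
have [[s p] /and3P[/= sp /eqP sm /eqP pm] sp_min] :=
  @arg_minP _ _ _ (s0, p0) good (fun x => #|moved x|) good0.
exists s, p; split=> // [t||t between]; rewrite ?sm ?pm//.
have [->|ts] := eqVneq t s; [by left|right].
have tm : perm_weight w t == m.
  have [t' tt'] := between_complement between.
  rewrite eq_le smin0 andbT -(lerD2r (perm_weight w t')) tt' sm pm.
  by rewrite lerD2l smin0.
have sub : moved (s, t) \subset moved (s, p).
  apply/fintype.subsetP => i; rewrite !inE /=.
  have /orP[/eqP->|/eqP->//] := forallP between i.
  by rewrite eqxx.
have moved_eq : moved (s, t) = moved (s, p).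
  apply/eqP; rewrite eqEcard sub; apply: sp_min.
  by rewrite /good /= sm tm eqxx eq_sym ts.
apply/permP => i; have := forallP between i => /orP[/eqP ti|/eqP//].
have : i \notin moved (s, t) by rewrite inE /= ti eqxx.
by rewrite moved_eq inE negbK ti => /eqP.
Qed.

(** The weight w0 exposing the face dual to C lies in C, hence in the tropical
determinant, so at least two permutations minimize it.  The cone of a closest
pair of minimizers contains C, and equals it by maximality. *)
Lemma maximal_cone_edge (C : set 'M[R]_n) : maximal_cone C ->
  exists s p, [/\ s != p, dual_to C s p &
    forall t, [forall i, (t i == s i) || (t i == p i)] -> t = s \/ t = p].
Proof.
move=> [[F [[w0 FE] F0 CE]] Ctrop Cmax].
have Cw0 : C w0 by rewrite CE => x y; rewrite FE => -[_ xmin]; exact: xmin.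
have [s0 _ s0min] :=
  @arg_minP _ _ _ 1%g xpredT (fun t : 'S_n => perm_weight w0 t) erefl.
have {}s0min t : perm_weight w0 s0 <= perm_weight w0 t by exact: s0min.
have [p0 [ps0 p0min]] : exists p0,
    p0 != s0 /\ perm_weight w0 p0 <= perm_weight w0 s0.
  apply: contrapT => /forallNP no_tie.
  apply: (tropical_det_unique_min (s := s0)) (Ctrop _ Cw0) => t ts.
  by rewrite ltNge; apply/negP => wt; apply: (no_tie t).
have [s [p [sp smin wsp between]]] : exists s p, [/\ s != p,
    forall t, perm_weight w0 s <= perm_weight w0 t,
    perm_weight w0 s = perm_weight w0 p &
    forall t, [forall i, (t i == s i) || (t i == p i)] -> t = s \/ t = p].
  apply: (@minimal_argmin_pair w0 s0 p0); rewrite 1?eq_sym// => t.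
  exact: le_trans p0min (s0min t).
have Fperm t : (forall u, perm_weight w0 t <= perm_weight w0 u) -> F (perm_mx t).
  move=> tmin; rewrite FE; split; first exact: birkhoff_perm.
  by move=> y; rewrite mxdot_perm_mx; exact: birkhoff_mxdot_ge.
have Fs := Fperm s smin.
have Fp : F (perm_mx p) by apply: Fperm; rewrite -wsp.
pose D := normal_cone (@birkhoff R n) (@perm_segment R n s p).
have CD : C `<=` D.
  move=> w; rewrite CE => wN; apply/normal_cone_perm_segment.
  have min_at t : F (perm_mx t) -> forall u, perm_weight w t <= perm_weight w u.
    move=> Ft u; rewrite -!mxdot_perm_mx; apply: wN => //.
    exact: birkhoff_perm.
  split; last exact: min_at.
  by apply/eqP; rewrite eq_le !min_at.
have edge : birkhoff_edge R s p.
  split; first exact/eqP.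
  have [s0' p0' off_gt0] := off_support_argmin R between.
  apply: (argmin_face_perm_segment (w := off_support R s p)).
    by rewrite s0' p0'.
  by move=> t ts tp; rewrite s0' off_gt0.
exists s, p; split=> //; split=> //; apply/esym/Cmax => //.
  exists (@perm_segment R n s p); split=> //; first by case: edge.
  by exists (perm_mx s); have [] := perm_segment_ends R s p.
move=> w /normal_cone_perm_segment[wsp' wmin].
by apply: trop_subset (edge_cone_sub_trop sp between wsp' wmin) => z [].
Qed.

End MinimalPair.

Local Close Scope ring_scope.
Local Close Scope classical_set_scope.

Theorem proposition3p5 (R : realType) (n : nat) (hn : n = 3 \/ n = 4)
    (C : set 'M[R]_n) (hC : maximal_cone C) :
  positive_cone C <-> ~ exists K, cartoon_of C K /\ has_marked_triangle K.
Proof.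
have n4 : (n <= 4)%N by case: hn => ->.
split.
  move=> C_pos [_ [[s [p [[edge CE] ->]]] /(marked_triangle_same_sign n4) sign]].
  have [w Dw wlt] := birkhoff_edge_argmin edge.
  by apply: (trop_positive_same_sign sign wlt); apply: C_pos; rewrite CE.
move=> no_triangle.
have [s [p [sp Csp between]]] := maximal_cone_edge hC.
have [_ CE] := Csp.
have signs : odd_perm s != odd_perm p.
  apply/eqP => sign; apply: no_triangle; exists (cartoon s p); split.
    by exists s, p.
  exact: same_sign_marked_triangle.
rewrite CE => w /normal_cone_perm_segment[wsp wmin].
apply: trop_subset (edge_cone_sub_trop sp between wsp wmin) => z [z_det z_pos].
by split=> //; exact: z_pos.
Qed.
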